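(* Let $\Omega\subset\mathbb{R}^d$ be an open bounded domain, let $B:\mathbb{H}_B\to L^2(\Omega)$ be a linear differential operator with graph space $\mathbb{H}_B$ as in the context (a Hilbert space, with $B$ boundedly invertible from $\mathbb{H}_B$ onto $L^2(\Omega)$), let $\mathbb{U}_h\subset\mathbb{H}_B$ be a finite-dimensional subspace, $\mathbb{V}=L^2(\Omega)$, and $f\in L^2(\Omega)$. Let $\varpi:L^2(\Omega)\to L^\infty(\Omega)$ be a differentiable map such that for some positive constants $\varpi_{\min},\varpi_{\max},\varpi_\infty',\varpi_L$: - $\varpi_{\min}\le\varpi(\xi)\le\varpi_{\max}$ (a.e. in $\Omega$), for all $\xi\in L^2(\Omega)$; - $\|\varpi'(\xi)\|_{\mathcal{L}(L^2(\Omega),L^\infty(\Omega))}\le\varpi_\infty'$, for all $\xi\in L^2(\Omega)$; - $\|\varpi'(\xi_1)-\varpi'(\xi_2)\|_{\mathcal{L}(L^2(\Omega),L^\infty(\Omega))}\le\varpi_L\|\xi_1-\xi_2\|_{L^2(\Omega)}$, for all $\xi_1,\xi_2\in L^2(\Omega)$. For $\xi\in\mathbb{X}:=L^2(\Omega)$ define $a(\xi;v_1,v_2):=(\varpi(\xi)v_1,v_2)_{L^2(\Omega)}$ for $v_1,v_2\in\mathbb{V}$ and $b(w,v):=(Bw,v)_{L^2(\Omega)}$ for $w\in\mathbb{H}_B$, $v\in\mathbb{V}$, and consider the mixed problem: find $(r,u_h)\in\mathbb{V}\times\mathbb{U}_h$ such that $$(\varpi(\xi)r,v)_{L^2(\Omega)}+(Bu_h,v)_{L^2(\Omega)}=(f,v)_{L^2(\Omega)}\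 \ \forall v\in\mathbb{V},\qquad (Bw_h,r)_{L^2(\Omega)}=0\ \ \forall w_h\in\mathbb{U}_h.$$ Then: (i) With $\hat{\mathbb{K}}:=\{v\in\mathbb{V}:b(w_h,v)=0\ \forall w_h\in\mathbb{U}_h\}$, for each $\xi\in\mathbb{X}$ there are constants $\alpha_h,\beta_h>0$ such that $$\inf_{v_1\in\hat{\mathbb{K}}}\sup_{v_2\in\hat{\mathbb{K}}}\frac{a(\xi;v_1,v_2)}{\|v_1\|_{\mathbb{V}}\|v_2\|_{\mathbb{V}}}\ge\alpha_h,\quad\{v_2\in\hat{\mathbb{K}}:a(\xi;v_1,v_2)=0\ \forall v_1\in\hat{\mathbb{K}}\}=\{0\},\quad\inf_{w_h\in\mathbb{U}_h}\sup_{v\in\mathbb{V}}\frac{b(w_h,v)}{\|w_h\|_{\mathbb{H}_B}\|v\|_{\mathbb{V}}}\ge\beta_h,$$ and thus the mixed problem is well-posed. (ii) The state operator $S_h:\mathbb{X}\to\mathbb{U}_h$, $S_h(\xi):=u_h$, is uniformly bounded on $\mathbb{X}=L^2(\Omega)$ and differentiable. (iii) The derivative $S_h'(\cdot)$ is uniformly bounded on $\mathbb{X}=L^2(\Omega)$ and Lipschitz continuous.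
   Context: The graph space $\mathbb{H}_B$ is the linear space of all $w\in L^2(\Omega)$ with $Bw\in L^2(\Omega)$ satisfying given (homogeneous linear) boundary conditions; it is assumed to be a Hilbert space with the inner product $(w_1,w_2)_{\mathbb{H}_B}:=(w_1,w_2)_{L^2(\Omega)}+(Bw_1,Bw_2)_{L^2(\Omega)}$, and $B:\mathbb{H}_B\to L^2(\Omega)$ is assumed to be boundedly invertible (onto). $L^2(\Omega)$ is identified with its dual. The mixed problem is a reformulation of the weighted least-squares problem of minimizing $\frac12\|\sqrt{\omega(\xi)}(f-Bw_h)\|_{L^2(\Omega)}^2$ over $w_h\in\mathbb{U}_h$, where $\omega=1/\varpi$. Differentiability is in the Gâteaux sense: $G$ is differentiable at $\xi$ if for every $\eta$ the limit $G'(\xi)\eta=\lim_{t\to0}(G(\xi+t\eta)-G(\xi))/t$ exists and $\eta\mapsto G'(\xi)\eta$ is linear and continuous. Well-posed means there is a unique solution for every $f\in L^2(\Omega)$, depending continuously on $f$. Uniform boundedness and Lipschitz continuity of $S_h'$ refer to the norm of $\mathcal{L}(L^2(\Omega),\mathbb{H}_B)$. Infima and suprema of quotients are over nonzero elements. *)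

(* Defs.v *)
From HB Require Import structures.
From mathcomp Require Import all_boot all_order all_algebra.
From mathcomp Require Import all_classical all_reals all_analysis.
From mathcomp Require Import measurable_realfun ess_sup_inf lra.

Set Implicit Arguments.
Unset Strict Implicit.
Unset Printing Implicit Defensive.

Import Order.TTheory GRing.Theory Num.Theory.
Import numFieldTopology.Exports numFieldNormedType.Exports.

Local Open Scope classical_set_scope.
Local Open Scope ring_scope.

Section euclidean_borel.
Context (R : realType) (d : nat).

(* Borel sigma-algebra of R^d *)
HB.instance Definition _ :=
  @isMeasurable.Build default_measure_display 'rV[R]_d
    <<s (@open 'rV[R]_d) >> (@sigma_algebra0 _ setT _)
    (@sigma_algebraC _ _) (@sigma_algebra_bigcup _ setT _).

Lemma open_measurable_rV (A : set 'rV[R]_d) : open A -> measurable A.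
Proof. exact: sub_sigma_algebra. Qed.

Lemma measurable_rV_coord (i : 'I_d) :
  measurable_fun [set: 'rV[R]_d] (fun x : 'rV[R]_d => x ord0 i).
Proof.
apply: (measurability (@RGenOpens.G R)); first exact: measurable_realfun.RGenOpens.measurableE.
move=> _ [_ [a [b ->]] <-]; rewrite setTI; apply: open_measurable_rV.
apply: open_comp; last exact: interval_open.
by move=> x _; exact: coord_continuous.
Qed.

Lemma measurable_fun_rV d1 (T : measurableType d1) (f : T -> 'rV[R]_d) :
  (forall i, measurable_fun [set: T] (fun t => f t ord0 i)) ->
  measurable_fun [set: T] f.
Proof.
move=> mf; apply: (measurability (@open 'rV[R]_d)) => //.
move=> _ [A oA <-]; rewrite setTI.
pose box (q : {ffun 'I_d -> rat * rat}) : set 'rV[R]_d :=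
  \bigcap_(i in [set: 'I_d])
     ((fun x : 'rV[R]_d => x ord0 i) @^-1` `](ratr (q i).1 : R), ratr (q i).2[).
have mbox q : measurable (f @^-1` box q).
  rewrite /box preimage_bigcap.
  apply: fin_bigcap_measurable; first exact: finite_finset.
  move=> i _; rewrite -[X in measurable X]setTI.
  by apply: mf => //; exact: measurable_itv.
have -> : A = \bigcup_(q in [set q | box q `<=` A]) box q.
  apply/seteqP; split=> [x Ax|x [q qA]]; last exact: qA.
  have /nbhs_ballP[e /= e0 xeA] : nbhs x A by exact: open_nbhs_nbhs.
  have ex (i : 'I_d) : exists q : rat * rat,
      [/\ x ord0 i - e < ratr q.1, ratr q.1 < x ord0 i,
          x ord0 i < ratr q.2 & ratr q.2 < x ord0 i + e].
    have [|a] := @rat_in_itvoo R (x ord0 i - e) (x ord0 i).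
      by rewrite ltrBlDr ltrDl.
    rewrite in_itv/= => /andP[a1 a2].
    have [|b] := @rat_in_itvoo R (x ord0 i) (x ord0 i + e).
      by rewrite ltrDl.
    by rewrite in_itv/= => /andP[b1 b2]; exists (a, b).
  have /choice[q qP] := ex.
  exists [ffun i => q i]; last first.
    by move=> i _ /=; rewrite ffunE in_itv/=; have [_ -> -> _] := qP i.
  move=> y yq; apply: xeA; split=> // i j; rewrite ord1.
  have := yq j Logic.I; rewrite /= ffunE in_itv/= => /andP[y1 y2].
  have [a1 _ _ b2] := qP j.
  rewrite /ball/= ltr_norml; apply/andP; split; lra.
rewrite preimage_bigcup bigcup_mkcond.
apply: countable_bigcupT_measurable => // q.
by case: ifP.
Qed.

End euclidean_borel.

Section euclidean_lebesgue.
Context (R : realType).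

Definition rV_cons n (p : R * 'rV[R]_n) : 'rV[R]_n.+1 :=
  row_mx (p.1%:M : 'rV_1) p.2.

Lemma rV_cons0 n (p : R * 'rV[R]_n) : rV_cons p ord0 ord0 = p.1.
Proof.
have := row_mxEl (p.1%:M : 'rV_1) p.2 ord0 (ord0 : 'I_1).
rewrite [X in _ = X]mxE eqxx mulr1n => <-; congr (row_mx _ _ _ _); exact: val_inj.
Qed.

Lemma rV_consS n (p : R * 'rV[R]_n) (j : 'I_n) :
  rV_cons p ord0 (lift ord0 j) = p.2 ord0 j.
Proof.
have <- := row_mxEr (p.1%:M : 'rV_1) p.2 ord0 j.
by congr (row_mx _ _ _ _); exact: val_inj.
Qed.

Lemma measurable_rV_cons n : measurable_fun setT (@rV_cons n).
Proof.
apply: measurable_fun_rV => i; case: (unliftP ord0 i) => [j|] ->.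
  apply: (eq_measurable_fun (fun p : R * 'rV[R]_n => p.2 ord0 j)) => [p _|].
    by rewrite rV_consS.
  exact: (measurableT_comp (measurable_rV_coord j) measurable_snd).
apply: (eq_measurable_fun (fun p : R * 'rV[R]_n => p.1)) => [p _|].
  by rewrite rV_cons0.
exact: measurable_fst.
Qed.

Definition rV_uncons n (x : 'rV[R]_n.+1) : R * 'rV[R]_n :=
  (x ord0 ord0, \row_j x ord0 (lift ord0 j)).

Lemma measurable_rV_uncons n : measurable_fun setT (@rV_uncons n).
Proof.
apply/measurable_fun_pairP; split; first exact: measurable_rV_coord.
apply: measurable_fun_rV => j.
apply: (eq_measurable_fun (fun x : 'rV[R]_n.+1 => x ord0 (lift ord0 j))).
  by move=> x _ /=; rewrite mxE.
exact: measurable_rV_coord.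
Qed.

Lemma rV_consK n : cancel (@rV_cons n) (@rV_uncons n).
Proof.
move=> [t x]; rewrite /rV_uncons rV_cons0; congr pair.
by apply/rowP => j; rewrite mxE rV_consS.
Qed.

Section step.
Context n (mu : {sigma_finite_measure set 'rV[R]_n -> \bar R}).

Definition lebesgue_rV_step : set 'rV[R]_n.+1 -> \bar R :=
  pushforward (@lebesgue_measure R \x mu)%E (@rV_cons n).

HB.instance Definition _ := Measure.copy lebesgue_rV_step
  (measure_function_pushforward__canonical__measure_function_Measure
     (@lebesgue_measure R \x mu)%E (@measurable_rV_cons n)).

Let lebesgue_rV_step_sigma_finite : sigma_finite setT lebesgue_rV_step.
Proof.
have [F FT Foo] : sigma_finite setT (@lebesgue_measure R \x mu)%E.
  have /sigma_finiteP[F [TF ndF Foo]] := sigma_finiteT (@lebesgue_measure R).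
  have /sigma_finiteP[G [TG ndG Goo]] := sigma_finiteT mu.
  exists (fun k => F k `*` G k).
    rewrite -setXTT TF TG predeqE => -[x y]; split.
      move=> [/= [i _ Fix] [k _ Gky]]; exists (maxn i k) => //; split.
      - by move: x Fix; exact/subsetPset/ndF/leq_maxl.
      - by move: y Gky; exact/subsetPset/ndG/leq_maxr.
    by move=> [i _ []/= ? ?]; split; exists i.
  move=> k; have [? ?] := Foo k; have [? ?] := Goo k.
  split; first exact: measurableX.
  by rewrite product_measure1E// lte_mul_pinfty// ge0_fin_numE.
exists (fun k => @rV_uncons n @^-1` F k).
  by rewrite -preimage_bigcup -FT preimage_setT.
move=> k; have [mF Fk] := Foo k; split.
  by rewrite -[X in measurable X]setTI; exact: measurable_rV_uncons.
rewrite /lebesgue_rV_step /pushforward -comp_preimage.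
by rewrite (_ : _ \o _ = id)//; apply/funext => p /=; rewrite rV_consK.
Qed.

HB.instance Definition _ := Measure_isSigmaFinite.Build _ _ _
  lebesgue_rV_step lebesgue_rV_step_sigma_finite.

End step.

(* Lebesgue measure on R^n, as an iterated product along R^(n+1) = R * R^n;
   its values on boxes are given by lebesgue_rV_box *)
Fixpoint lebesgue_rV n : {sigma_finite_measure set 'rV[R]_n -> \bar R} :=
  if n is n'.+1 then lebesgue_rV_step (lebesgue_rV n')
  else \d_(0 : 'rV[R]_0).

End euclidean_lebesgue.

Lemma lebesgue_rV_box (R : realType) n (a b : 'rV[R]_n) :
  (forall i, a ord0 i <= b ord0 i) ->
  lebesgue_rV R n [set x | forall i, a ord0 i <= x ord0 i <= b ord0 i] =
  (\prod_(i < n) (b ord0 i - a ord0 i))%:E.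
Proof.
elim: n a b => [|n IHn] a b ab.
  by rewrite big_ord0 /= diracE mem_set//= => -[].
pose a' : 'rV[R]_n := \row_j a ord0 (lift ord0 j).
pose b' : 'rV[R]_n := \row_j b ord0 (lift ord0 j).
have mbox : measurable [set x : 'rV[R]_n |
    forall i, a' ord0 i <= x ord0 i <= b' ord0 i].
  rewrite [X in measurable X](_ : _ = \bigcap_(i in [set: 'I_n])
     ((fun x : 'rV[R]_n => x ord0 i) @^-1` `[a' ord0 i, b' ord0 i])).
    apply: fin_bigcap_measurable; first exact: finite_finset.
    move=> i _; rewrite -[X in measurable X]setTI.
    exact: (@measurable_rV_coord R n i measurableT _ (@measurable_itv R _)).
  apply/seteqP; split=> x /= xab i; first by move=> _ /=; rewrite in_itv/=.
  by have := xab i Logic.I; rewrite /= in_itv.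
rewrite /= /lebesgue_rV_step /pushforward.
rewrite [X in product_measure1 _ _ X](_ : _ =
  `[a ord0 ord0, b ord0 ord0]%classic `*`
  [set x : 'rV[R]_n | forall i, a' ord0 i <= x ord0 i <= b' ord0 i]); last first.
  apply/seteqP; split=> -[t x] /=.
    move=> xab; split=> [|i].
      by have := xab ord0; rewrite rV_cons0 in_itv.
    by have := xab (lift ord0 i); rewrite rV_consS !mxE.
  move=> [tab xab] i; case: (unliftP ord0 i) => [j|] ->.
    by have := xab j; rewrite rV_consS !mxE.
  by rewrite rV_cons0; move: tab; rewrite in_itv.
rewrite (product_measure1E (@lebesgue_measure R) _ (measurable_itv _) mbox).
rewrite IHn => [|i]; last by rewrite !mxE.
rewrite big_ord_recl EFinM; congr (_ * _)%E; last first.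
  by congr (_%:E); apply: eq_bigr => i _; rewrite !mxE.
apply: etrans; first exact: (@lebesgue_measure_itv R `[a ord0 ord0, b ord0 ord0]).
rewrite /= lte_fin; case: ltP => // ba.
by have /eqP -> : a ord0 ord0 == b ord0 ord0; rewrite ?eq_le ?ab ?ba// subrr.
Qed.

(* The library's L^p space of classes of functions, here made a normed module.
   The algebraic operations act pointwise on representatives (Lspace_addE,
   Lspace_oppE, Lspace_scaleE, Lspace_zeroE). *)
Section Lspace_normed.
Context d (T : measurableType d) (R : realType).
Variables (mu : {measure set T -> \bar R}) (p : \bar R) (p1 : (1 <= p)%E).

Notation Lp := (LspaceType mu p1).
Notation Lf := (LfunType mu p1).
Notation M := {mfun_ mu, T >-> measurableTypeR R}.

Lemma eq_Lnorm_ae (f g : T -> R) :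
  measurable_fun setT f -> measurable_fun setT g -> f = g %[ae mu] ->
  'N[mu]_p[EFin \o f]%E = 'N[mu]_p[EFin \o g]%E.
Proof.
move=> mf mg fg; rewrite unlock; case: p p1 => [r r1|_|//].
  congr (_ `^ _)%E; apply: ae_eq_integral => //.
  - apply: (@measurableT_comp _ _ _ _ _ _ (fun x : \bar R => x `^ r)%E
      _ (fun x => `|(EFin \o f) x|%E)).
      exact: measurable_poweR.
    by apply: measurableT_comp => //; exact: measurableT_comp.
  - apply: (@measurableT_comp _ _ _ _ _ _ (fun x : \bar R => x `^ r)%E
      _ (fun x => `|(EFin \o g) x|%E)).
      exact: measurable_poweR.
    by apply: measurableT_comp => //; exact: measurableT_comp.
  - by apply: filterS fg => x /[apply] /= ->.
case: ifPn => // _; apply: eq_ess_sup.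
by apply: filterS fg => x /(_ Logic.I) /= ->.
Qed.

HB.instance Definition _ := gen_eqMixin Lp.
HB.instance Definition _ := gen_choiceMixin Lp.

Definition Lspace_fun (f : Lp) : T -> R := f.

Lemma measurable_Lspace_fun (f : Lp) : measurable_fun setT (Lspace_fun f).
Proof. exact: (@measurable_funPT _ _ _ _ (repr (LebesgueSpace.sort f))). Qed.

Lemma Lspace_funP (f : Lp) : Lspace_fun f \in Lfun mu p.
Proof.
apply/andP; split; rewrite inE/=; first exact: measurable_Lspace_fun.
exact: (@Lebesgue_finite _ _ _ _ _ _ f).
Qed.

Definition Lspace_repr (f : Lp) : Lf := Lfun_Sub p1 (Lspace_funP f).

Lemma Lspace_ext (f g : Lp) : Lspace_fun f = Lspace_fun g %[ae mu] -> f = g.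
Proof.
case: f g => [f [[cf]]] [g [[cg]]] fg.
have {}fg : f = g.
  by rewrite -[f]reprK -[g]reprK; apply/eqmodP/asboolP.
by subst g; rewrite (Prop_irrelevance cf cg).
Qed.

Let Lfun_mfun (f : Lf) : {mfun T >-> measurableTypeR R} :=
  HB.pack_for {mfun T >-> measurableTypeR R} (f : T -> measurableTypeR R)
    (isMeasurableFun.Build _ _ T (measurableTypeR R) f
       (@measurable_funPT _ _ _ _ f)).

Definition Lspace_quot (f : Lf) : M := (\pi_M (Lfun_mfun f))%qT.

Lemma Lspace_quotE (f : Lf) :
  (Lspace_quot f : T -> R) = (f : T -> R) %[ae mu].
Proof.
by have /eqmodP/asboolP := reprK (Lspace_quot f).
Qed.

Lemma Lspace_quot_fin (f : Lf) : finite_norm mu p (Lspace_quot f).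
Proof.
rewrite /finite_norm (eq_Lnorm_ae _ _ (Lspace_quotE f)).
- exact: Lfunction_finite.
- exact: (@measurable_funPT _ _ _ _ (repr (Lspace_quot f))).
- exact: measurable_funPT.
Qed.

Definition Lspace_class (f : Lf) : Lp :=
  LebesgueSpace.Pack (LebesgueSpace.Class
    (isFinLebesgue.Axioms_ _ _ _ _ p1 _ (Lspace_quot_fin f))).

Lemma Lspace_classE (f : Lf) :
  Lspace_fun (Lspace_class f) = (f : T -> R) %[ae mu].
Proof. exact: Lspace_quotE. Qed.

Definition Lspace_add (f g : Lp) : Lp :=
  Lspace_class (Lspace_repr f + Lspace_repr g).
Definition Lspace_opp (f : Lp) : Lp := Lspace_class (- Lspace_repr f).
Definition Lspace_scale (a : R) (f : Lp) : Lp :=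
  Lspace_class (a *: Lspace_repr f).
Definition Lspace_zero : Lp := Lspace_class 0.

Lemma Lspace_addE (f g : Lp) : 
  \forall x \ae mu, Lspace_fun (Lspace_add f g) x =
    Lspace_fun f x + Lspace_fun g x.
Proof. by apply: filterS (Lspace_classE (Lspace_repr f + Lspace_repr g)) => x /(_ Logic.I) ->. Qed.

Lemma Lspace_oppE (f : Lp) : 
  \forall x \ae mu, Lspace_fun (Lspace_opp f) x = - Lspace_fun f x.
Proof. by apply: filterS (Lspace_classE (- Lspace_repr f)) => x /(_ Logic.I) ->. Qed.

Lemma Lspace_scaleE a (f : Lp) : 
  \forall x \ae mu, Lspace_fun (Lspace_scale a f) x = a * Lspace_fun f x.
Proof. by apply: filterS (Lspace_classE (a *: Lspace_repr f)) => x /(_ Logic.I) ->. Qed.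

Lemma Lspace_zeroE : \forall x \ae mu, Lspace_fun Lspace_zero x = 0.
Proof. by apply: filterS (Lspace_classE 0) => x /(_ Logic.I) ->. Qed.

Let addA : associative Lspace_add.
Proof.
move=> f g h; apply: Lspace_ext; near=> x => _.
rewrite (near (Lspace_addE f (Lspace_add g h)) x)//.
rewrite (near (Lspace_addE g h) x)//.
rewrite (near (Lspace_addE (Lspace_add f g) h) x)//.
by rewrite (near (Lspace_addE f g) x)// addrA.
Unshelve. all: by end_near. Qed.

Let addC : commutative Lspace_add.
Proof.
move=> f g; apply: Lspace_ext; near=> x => _.
rewrite (near (Lspace_addE f g) x)//.
by rewrite (near (Lspace_addE g f) x)// addrC.
Unshelve. all: by end_near. Qed.

Let add0 : left_id Lspace_zero Lspace_add.
Proof.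
move=> f; apply: Lspace_ext; near=> x => _.
rewrite (near (Lspace_addE Lspace_zero f) x)//.
by rewrite (near Lspace_zeroE x)// add0r.
Unshelve. all: by end_near. Qed.

Let addN : left_inverse Lspace_zero Lspace_opp Lspace_add.
Proof.
move=> f; apply: Lspace_ext; near=> x => _.
rewrite (near (Lspace_addE (Lspace_opp f) f) x)//.
rewrite (near (Lspace_oppE f) x)//.
by rewrite (near Lspace_zeroE x)// addNr.
Unshelve. all: by end_near. Qed.

HB.instance Definition _ := GRing.isZmodule.Build Lp addA addC add0 addN.

Let scaleA a b v :
  Lspace_scale a (Lspace_scale b v) = Lspace_scale (a * b) v.
Proof.
apply: Lspace_ext; near=> x => _.
rewrite (near (Lspace_scaleE a (Lspace_scale b v)) x)//.
rewrite (near (Lspace_scaleE b v) x)//.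
by rewrite (near (Lspace_scaleE (a * b) v) x)// mulrA.
Unshelve. all: by end_near. Qed.

Let scale1 : left_id 1 Lspace_scale.
Proof.
move=> f; apply: Lspace_ext; near=> x => _.
by rewrite (near (Lspace_scaleE 1 f) x)// mul1r.
Unshelve. all: by end_near. Qed.

Let scaleDr : right_distributive Lspace_scale +%R.
Proof.
move=> a f g; apply: Lspace_ext.
near=> x => _.
rewrite (near (Lspace_scaleE a (Lspace_add f g)) x)//.
rewrite (near (Lspace_addE f g) x)//.
rewrite (near (Lspace_addE (Lspace_scale a f) (Lspace_scale a g)) x)//.
rewrite (near (Lspace_scaleE a f) x)// (near (Lspace_scaleE a g) x)//.
by rewrite mulrDr.
Unshelve. all: by end_near. Qed.

Let scaleDl v : {morph Lspace_scale^~ v : a b / a + b}.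
Proof.
move=> a b; apply: Lspace_ext.
near=> x => _.
rewrite (near (Lspace_scaleE (a + b) v) x)//.
rewrite (near (Lspace_addE (Lspace_scale a v) (Lspace_scale b v)) x)//.
rewrite (near (Lspace_scaleE a v) x)// (near (Lspace_scaleE b v) x)//.
by rewrite mulrDl.
Unshelve. all: by end_near. Qed.

HB.instance Definition _ :=
  GRing.Zmodule_isLmodule.Build R Lp scaleA scale1 scaleDr scaleDl.

Definition Lspace_norm (f : Lp) : R := fine 'N[mu]_p[EFin \o Lspace_fun f]%E.

Let Lspace_norm_class (f : Lf) :
  Lspace_norm (Lspace_class f) = fine 'N[mu]_p[EFin \o f]%E.
Proof.
rewrite /Lspace_norm (eq_Lnorm_ae _ _ (Lspace_classE f))//.
exact: measurable_Lspace_fun.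
Qed.

Let normD f g : Lspace_norm (f + g) <= Lspace_norm f + Lspace_norm g.
Proof. by rewrite Lspace_norm_class; exact: ler_LnormD. Qed.

Let normZ a f : Lspace_norm (a *: f) = `|a| * Lspace_norm f.
Proof.
by rewrite Lspace_norm_class /Lspace_norm LnormZ -finite_norm_fine -EFinM.
Qed.

Let norm_eq0 f : Lspace_norm f = 0 -> f = 0.
Proof.
move=> /(@fine_Lnormr_eq0 _ _ _ mu p p1 (Lspace_repr f)) f0; apply: Lspace_ext.
near=> x => _; rewrite (near Lspace_zeroE x)//.
exact: (near f0 x).
Unshelve. all: by end_near. Qed.

HB.instance Definition _ := Lmodule_isNormed.Build R Lp normD normZ norm_eq0.

End Lspace_normed.

Section graph_space.
Context (R : realType) (V W : normedModType R).

Record op_dom (D : submodClosed V) := OpDom { op_dom_val :> V; _ : op_dom_val \in D }.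

HB.instance Definition _ (D : submodClosed V) := [isSub for @op_dom_val D].
HB.instance Definition _ (D : submodClosed V) := [Choice of op_dom D by <:].
HB.instance Definition _ (D : submodClosed V) :=
  [SubChoice_isSubLmodule of op_dom D by <:].

(* The domain of an operator B, normed by the graph norm below. *)
Definition graph_space (D : submodClosed V) (B : {linear op_dom D -> W}) : Type :=
  op_dom D.

Section norm.
Variables (D : submodClosed V) (B : {linear op_dom D -> W}).

HB.instance Definition _ := GRing.Lmodule.on (graph_space B).

(* the norm of the inner product (u, v) + (B u, B v) when V and W are inner
   product spaces *)
Definition graph_norm (w : graph_space B) : R :=
  Num.sqrt (`|op_dom_val w| ^+ 2 + `|B w| ^+ 2).

Let normD (u v : graph_space B) :
  graph_norm (u + v) <= graph_norm u + graph_norm v.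
Proof.
have minkowski2 (a b c e : R) : Num.sqrt ((a + c) ^+ 2 + (b + e) ^+ 2) <=
    Num.sqrt (a ^+ 2 + b ^+ 2) + Num.sqrt (c ^+ 2 + e ^+ 2).
  set s := Num.sqrt (_ ^+ 2 + b ^+ 2); set t := Num.sqrt (_ ^+ 2 + e ^+ 2).
  have s0 : 0 <= s by exact: sqrtr_ge0.
  have t0 : 0 <= t by exact: sqrtr_ge0.
  have s2 : s ^+ 2 = a ^+ 2 + b ^+ 2 by rewrite sqr_sqrtr// addr_ge0// sqr_ge0.
  have t2 : t ^+ 2 = c ^+ 2 + e ^+ 2 by rewrite sqr_sqrtr// addr_ge0// sqr_ge0.
  have cs : a * c + b * e <= s * t.
    apply: le_trans (ler_norm _) _.
    rewrite -(@ler_pXn2r _ 2)// ?nnegrE ?mulr_ge0// real_normK ?num_real//.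
    rewrite exprMn s2 t2; have := sqr_ge0 (a * e - b * c); nra.
  rewrite -(@ler_pXn2r _ 2)// ?nnegrE ?addr_ge0 ?sqrtr_ge0//.
  rewrite sqr_sqrtr ?addr_ge0 ?sqr_ge0//; nra.
apply: le_trans (minkowski2 _ _ _ _); apply: ler_wsqrtr; apply: lerD.
  by rewrite ler_pXn2r ?nnegrE ?addr_ge0 ?ler_normD.
by rewrite linearD ler_pXn2r ?nnegrE ?addr_ge0 ?ler_normD.
Qed.

Let normZ (a : R) (u : graph_space B) :
  graph_norm (a *: u) = `|a| * graph_norm u.
Proof.
rewrite /graph_norm linearZ/= !normrZ !exprMn -mulrDr sqrtrM ?sqr_ge0//.
by rewrite sqrtr_sqr normr_id.
Qed.

Let norm_eq0 (u : graph_space B) : graph_norm u = 0 -> u = 0.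
Proof.
move/eqP; rewrite sqrtr_eq0 => u0; apply/val_inj/eqP; rewrite -normr_eq0.
rewrite -sqrf_eq0 eq_le sqr_ge0 andbT (le_trans _ u0)//.
by rewrite lerDl sqr_ge0.
Qed.

HB.instance Definition _ :=
  Lmodule_isNormed.Build R (graph_space B) normD normZ norm_eq0.

End norm.
End graph_space.

Section domains.
Context (R : realType) (d : nat).

Record bounded_domain := BoundedDomain {
  domain_set :> set 'rV[R]_d;
  domain_open : open domain_set;
  domain_bounded : bounded_set domain_set;
  domain_connected : connected domain_set;
  domain_nonempty : domain_set !=set0 }.

(* Lebesgue measure of R^d restricted to Omega: almost everywhere and the L^p
   spaces for this measure are those of Omega *)
Definition lebesgue_on (Omega : bounded_domain) : set 'rV[R]_d -> \bar R :=
  mrestr (lebesgue_rV R d) (open_measurable_rV (@domain_open Omega)).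

HB.instance Definition _ (Omega : bounded_domain) :=
  Measure.on (lebesgue_on Omega).

End domains.

Notation L2 Omega := (LspaceType2 (lebesgue_on Omega)).
Notation Linfty Omega := (LspaceType (lebesgue_on Omega) (leey 1%E)).

Section L2_inner.
Context (R : realType) (d : nat) (Omega : bounded_domain R d).

Definition L2dot (f g : 'rV[R]_d -> R) : R :=
  \int[lebesgue_on Omega]_x (f x * g x).

End L2_inner.

Section L2_norms.
Context (R : realType) (d : nat) (Omega : bounded_domain R d).

Lemma L2dot_normE (f : L2 Omega) : `|f| ^+ 2 = L2dot Omega f f.
Proof.
have N0 := Lnorm_ge0 (lebesgue_on Omega) 2%:E (EFin \o Lspace_fun f).
have Nfin : 'N[lebesgue_on Omega]_2%:E[EFin \o Lspace_fun f]%E \is a fin_num.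
  by rewrite ge0_fin_numE//; exact: (@Lebesgue_finite _ _ _ _ _ _ f).
rewrite -[LHS]/((fine 'N[lebesgue_on Omega]_2%:E[EFin \o Lspace_fun f]%E) ^+ 2).
apply/EFin_inj; rewrite EFin_expe fineK//.
rewrite /L2dot /Rintegral.
have -> : ('N[lebesgue_on Omega]_2%:E[EFin \o Lspace_fun f] ^+ 2 =
  'N[lebesgue_on Omega]_2%:E[EFin \o Lspace_fun f] `^ 2)%E.
  by rewrite -(fineK Nfin) -EFin_expe poweR_EFin powR_mulrn// fine_ge0.
have E : ('N[lebesgue_on Omega]_2%:E[EFin \o Lspace_fun f] `^ 2 =
   \int[lebesgue_on Omega]_x (f x * f x)%:E)%E.
  rewrite poweR_Lnorm//; apply: eq_integral => x _ /=.
  transitivity ((`|Lspace_fun f x| `^ 2)%:E); first by [].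
  rewrite powR_mulrn ?normr_ge0// real_normK ?num_real//.
rewrite E fineK// -E -(fineK Nfin) poweR_EFin//.
Qed.

Lemma graph_norm_sqr (D : submodClosed (L2 Omega))
    (B : {linear op_dom D -> L2 Omega}) (w : graph_space B) :
  `|w| ^+ 2 = L2dot Omega (op_dom_val w) (op_dom_val w) + L2dot Omega (B w) (B w).
Proof.
by rewrite -!L2dot_normE sqr_sqrtr// addr_ge0 ?sqr_ge0.
Qed.

End L2_norms.

Section differential_operators.
Context (R : realType) (d : nat).
Implicit Types (Omega : bounded_domain R d) (phi u v : 'rV[R]_d -> R).

Definition partial (i : 'I_d) phi : 'rV[R]_d -> R :=
  fun x => 'D_(delta_mx ord0 i) phi x.

(* Multi-indices are encoded as lists of directions of differentiation. *)
Definition partials (s : seq 'I_d) phi : 'rV[R]_d -> R := foldr partial phi s.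

Definition smooth phi : Prop := forall s : seq 'I_d,
  continuous (partials s phi) /\
  forall (i : 'I_d) x, derivable (partials s phi) x (delta_mx ord0 i).

Definition test_function Omega phi : Prop := smooth phi /\
  exists K : set 'rV[R]_d,
    [/\ compact K, K `<=` Omega & forall x, ~ K x -> phi x = 0].

Definition locally_integrable_on Omega u : Prop :=
  forall K : set 'rV[R]_d, compact K -> K `<=` Omega ->
    (lebesgue_rV R d).-integrable K (EFin \o u).

Definition weak_partials Omega (s : seq 'I_d) u v : Prop :=
  [/\ locally_integrable_on Omega u, locally_integrable_on Omega v &
   forall phi, test_function Omega phi ->
     L2dot Omega u (partials s phi) = (-1) ^+ size s * L2dot Omega v phi].

(* The formal expression w |-> \sum_k D^(outer k) (coef k * D^(inner k) w).  It
   covers the non-divergence form (outer k = [::]), the conservative form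
   (inner k = [::]) and the divergence form, with coefficients that need not be
   smooth. *)
Record diff_expr := DiffExpr {
  nterms : nat;
  outer : 'I_nterms -> seq 'I_d;
  coef : 'I_nterms -> 'rV[R]_d -> R;
  inner : 'I_nterms -> seq 'I_d;
  measurable_coef : forall k, measurable_fun setT (coef k) }.

(* P w = g in the sense of distributions on Omega *)
Definition diff_apply Omega (P : diff_expr) (w g : 'rV[R]_d -> R) : Prop :=
  exists D : 'I_(nterms P) -> 'rV[R]_d -> R,
    (forall k, weak_partials Omega (inner k) w (D k) /\
               locally_integrable_on Omega (fun x => coef k x * D k x)) /\
    (forall phi, test_function Omega phi ->
       \sum_(k < nterms P) (-1) ^+ size (outer k) *
         L2dot Omega (fun x => coef k x * D k x) (partials (outer k) phi) =
       L2dot Omega g phi).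

(* A homogeneous linear condition which is insensitive to changes of the
   function away from the boundary of Omega. *)
Definition boundary_condition Omega (bc : set (L2 Omega)) : Prop :=
  [/\ bc 0,
      forall (a : R) (u v : L2 Omega), bc u -> bc v -> bc (a *: u + v) &
      forall (K : set 'rV[R]_d) (u v : L2 Omega), compact K -> K `<=` Omega ->
        {ae lebesgue_on Omega, forall x, ~ K x -> u x = v x} -> bc u -> bc v].

(* D is the space of the w in L^2 with P w in L^2 satisfying the boundary
   conditions, and B is the restriction of P to D. *)
Definition graph_operator Omega (P : diff_expr) (bc : set (L2 Omega))
    (D : submodClosed (L2 Omega)) (B : {linear op_dom D -> L2 Omega}) : Prop :=
  (forall w : L2 Omega,
     w \in D <-> (exists g : L2 Omega, diff_apply Omega P w g) /\ bc w) /\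
  (forall w : op_dom D, diff_apply Omega P (op_dom_val w) (B w)).

End differential_operators.

Section functional_analysis.
Context (R : realType) (V W : normedModType R).

Definition complete_space : Prop :=
  forall F : set_system V, ProperFilter F -> cauchy F -> cvg F.

Definition boundedly_invertible (B : V -> W) : Prop :=
  exists Binv : W -> V, [/\ cancel B Binv, cancel Binv B & continuous Binv].

Definition finite_dim_subspace (U : set V) : Prop :=
  exists (n : nat) (e : 'I_n -> V),
    U = [set w | exists c : 'I_n -> R, w = \sum_(i < n) c i *: e i].

(* For linear A this is the operator norm, +oo when A is unbounded. *)
Definition opnorm (A : V -> W) : \bar R :=
  ereal_sup [set `|A v|%:E | v in [set v | `|v| <= 1]].

Definition gateaux (G : V -> W) (x : V) : V -> W := fun v => 'D_v G x.

Definition gateaux_differentiable (G : V -> W) : Prop := forall x : V,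
  [/\ forall v, derivable G x v, linear (gateaux G x)
    & continuous (gateaux G x)].

Definition inf_sup (A : set V) (C : set W) (c : V -> W -> R) : \bar R :=
  ereal_inf [set ereal_sup [set (c v w / (`|v| * `|w|))%:E | w in C `\ 0]
            | v in A `\ 0].

End functional_analysis.
Arguments complete_space {R} V.

Section mixed_problem.
Context (R : realType) (d : nat) (Omega : bounded_domain R d).
Variables (D : submodClosed (L2 Omega)) (B : {linear op_dom D -> L2 Omega}).
Variables (Uh : set (graph_space B)) (varpi : L2 Omega -> Linfty Omega).

Definition form_a (xi v1 v2 : L2 Omega) : R :=
  L2dot Omega (fun x => varpi xi x * v1 x) v2.

Definition form_b (w : graph_space B) (v : L2 Omega) : R := L2dot Omega (B w) v.

Definition Khat : set (L2 Omega) :=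
  [set v | forall wh, Uh wh -> form_b wh v = 0].

Definition mixed_solution (xi f : L2 Omega) (ru : L2 Omega * graph_space B) :
    Prop :=
  [/\ Uh ru.2,
      forall v, form_a xi ru.1 v + form_b ru.2 v = L2dot Omega f v &
      forall wh, Uh wh -> form_b wh ru.1 = 0].

Definition mixed_well_posed (xi : L2 Omega) : Prop :=
  exists sol : L2 Omega -> L2 Omega * graph_space B, continuous sol /\
    forall f, mixed_solution xi f (sol f) /\
      forall ru, mixed_solution xi f ru -> ru = sol f.

(* the component u_h of the solution of the mixed problem, which is unique by
   well-posedness *)
Definition state_operator (f xi : L2 Omega) : graph_space B :=
  (get [set ru | mixed_solution xi f ru]).2.

End mixed_problem.

(* Main.v *)
From HB Require Import structures.
Require Import Defs.
From mathcomp Require Import all_boot all_order all_algebra.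
From mathcomp Require Import all_classical all_reals all_analysis.
From mathcomp Require Import measurable_realfun ess_sup_inf ring lra.

(* For a fixed weight, coercivity bounds the residual r by |f| / varpi_min and
   hence B u_h by a multiple of |f|; existence reduces to a Galerkin system for
   the inner product weighted by 1 / varpi. If (r_x, u_x) solves the problem
   with weight varpi(x), then (r_y - r_x, u_y - u_x) solves the problem at x
   with right-hand side - (varpi(y) - varpi(x)) r_y. Hence S_h'(x) v is the
   state solving the problem at x with right-hand side - (varpi'(x) v) r_x, and
   the uniform and Lipschitz bounds on S_h' follow from those on the solution
   operator and on varpi'. *)

Set Implicit Arguments.
Unset Strict Implicit.
Unset Printing Implicit Defensive.

Import Order.TTheory GRing.Theory Num.Theory.
Import numFieldTopology.Exports numFieldNormedType.Exports.

Local Open Scope classical_set_scope.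
Local Open Scope ring_scope.

(* The defect lies in the column space of the Gram matrix because the kernel of
   the Gram matrix consists of linear relations between the e_i. *)
Lemma galerkin_exists (R : fieldType) (V : lmodType R) (a : V -> V -> R)
    (linl : forall y, scalar (a^~ y)) (linr : forall x, scalar (a x))
    (definite : forall x, a x x = 0 -> x = 0) n (e : 'I_n -> V) (f : V) :
  exists c : 'I_n -> R, forall i, a (f - \sum_(j < n) c j *: e j) (e i) = 0.
Proof.
pose al y : {scalar V} := HB.pack (a^~ y)
  (GRing.isLinear.Build R V R *%R _ (linl y)).
pose ar x : {scalar V} := HB.pack (a x)
  (GRing.isLinear.Build R V R *%R _ (linr x)).
have suml k y : a (\sum_j k j *: e j) y = \sum_j k j * a (e j) y.
  by rewrite -[LHS]/(al y _) linear_sum; apply: eq_bigr => j _; rewrite linearZ.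
have sumr k x : a x (\sum_j k j *: e j) = \sum_j k j * a x (e j).
  by rewrite -[LHS]/(ar x _) linear_sum; apply: eq_bigr => j _; rewrite linearZ.
pose G : 'M[R]_n := \matrix_(j, i) a (e j) (e i).
pose b : 'rV[R]_n := \row_i a f (e i).
have /submxP[c bE] : (b <= G)%MS.
  rewrite submxE; apply/eqP/rowP => k; rewrite !mxE.
  pose K := cokermx G.
  have GK j : \sum_i K i k * a (e j) (e i) = 0.
    have := mulmx_coker G => /matrixP/(_ j k); rewrite !mxE => {2}<-.
    by apply: eq_bigr => i _; rewrite !mxE mulrC.
  have K0 : \sum_i K i k *: e i = 0.
    by apply: definite; rewrite suml big1// => j _; rewrite sumr GK mulr0.
  transitivity (a f (\sum_i K i k *: e i)).
    by rewrite sumr; apply: eq_bigr => i _; rewrite !mxE mulrC.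
  by rewrite K0; exact: (linear0 (ar f)).
exists (fun j => c 0 j) => i.
rewrite -[LHS]/(al _ _) linearB/= suml.
have := bE => /rowP/(_ i); rewrite !mxE => ->.
by apply/eqP; rewrite subr_eq0; apply/eqP/eq_bigr => j _; rewrite !mxE.
Qed.

(** * Operator norms, inf-sup constants and bounded inverses *)

Section operator_norms.
Context (R : realType) (V W : normedModType R).
Implicit Types (A : V -> W) (k : R).

Lemma opnorm_le A k : 0 <= k -> (forall v, `|A v| <= k * `|v|) ->
  (opnorm A <= k%:E)%E.
Proof.
move=> k0 Ak; apply: ge_ereal_sup => _ [v /= v1 <-]; rewrite lee_fin.
by rewrite (le_trans (Ak v))// ler_piMr.
Qed.

(** Normalising [v] uses homogeneity alone, a property that a pointwise difference of two
    derivatives visibly inherits. *)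
Lemma le_opnorm A k : scalable A -> (opnorm A <= k%:E)%E ->
  forall v, `|A v| <= k * `|v|.
Proof.
move=> AZ Ak v; have [->|v0] := eqVneq v 0.
  by have := AZ 0 0; rewrite !scale0r => ->; rewrite !normr0 mulr0.
have nv : 0 < `|v| by rewrite normr_gt0.
have : (`|A (`|v|^-1 *: v)|%:E <= opnorm A)%E.
  apply: ereal_sup_ubound; exists (`|v|^-1 *: v) => //=.
  by rewrite normrZ ger0_norm ?invr_ge0// mulVf// gt_eqF.
move=> /le_trans/(_ Ak); rewrite lee_fin AZ normrZ ger0_norm ?invr_ge0//.
by rewrite mulrC ler_pdivrMr.
Qed.

(** One good test element for each [v] bounds the inner supremum from below; if [E] has no nonzero
    element, the infimum is [+oo]. *)
Lemma inf_sup_ge (E : set V) (F : set W) (c : V -> W -> R) k :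
  (forall v, E v -> v != 0 ->
     exists w, [/\ F w, w != 0 & k * (`|v| * `|w|) <= c v w]) ->
  (k%:E <= inf_sup E F c)%E.
Proof.
move=> H; apply: le_ereal_inf_tmp => _ [v [Ev /eqP v0] <-].
have [w [Fw w0 kc]] := H v Ev v0.
apply: (@le_trans _ _ (c v w / (`|v| * `|w|))%:E).
  by rewrite lee_fin ler_pdivlMr// mulr_gt0// normr_gt0.
by apply: ereal_sup_ubound; exists w => //; split => //; apply/eqP.
Qed.

Lemma linear_le_continuous (L : {linear V -> W}) k :
  (forall v, `|L v| <= k * `|v|) -> continuous L.
Proof.
move=> Lk; apply/bounded_linear_continuous/linear_boundedP.
by near=> r => w; rewrite (le_trans (Lk w))// ler_wpM2r//.
Unshelve. all: by end_near. Qed.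

(** Continuity of the inverse at 0 makes it bounded, and the bound is read at [L v]. For [B] this
    constant controls [u_h] by [B u_h], and its reciprocal serves as the inf-sup constant of [b]. *)
Lemma boundedly_invertible_le (L : {linear V -> W}) : boundedly_invertible L ->
  exists2 k, 0 < k & forall v, `|v| <= k * `|L v|.
Proof.
move=> [Linv [LK LinvK cLinv]].
have Linv_linear : linear Linv by exact: can2_linear LK LinvK.
pose N : {linear W -> V} := HB.pack Linv (GRing.isLinear.Build R W V *:%R _ Linv_linear).
have /linear_boundedP Nk : bounded_near N (nbhs (0 : W)).
  by apply: continuous_linear_bounded; exact: cLinv.
near (pinfty_nbhs R) => k; exists k => // v; rewrite -{1}[v]LK.
by move: (L v); near: k.
Unshelve. all: by end_near. Qed.

End operator_norms.

(** * Mean value estimate along segments *)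

Section functional_mean_value.
Context (R : realType) (V W : normedModType R).

Lemma derivable_functional (G : V -> W) (L : {linear W -> R^o}) (k : R) x v :
  (forall w, `|L w| <= k * `|w|) -> derivable G x v ->
  is_derive x v (L \o G : V -> R^o) (L ('D_v G x)).
Proof.
move=> Lk dG.
have cL := linear_le_continuous Lk.
have c : (fun h => h^-1 *: ((L \o G \o shift x) (h *: v) - (L \o G) x)) @ 0^'
    --> (L ('D_v G x) : R^o).
  rewrite (_ : (fun h => _) =
    L \o (fun h : R => h^-1 *: ((G \o shift x) (h *: v) - G x))); last first.
    by apply/funext => h /=; rewrite -linearB linearZ_LR.
  by apply: continuous_cvg; [exact: cL|exact: dG].
by apply: DeriveDef; [apply/cvg_ex; exists (L ('D_v G x))|apply/cvg_lim].
Qed.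

(** Along the segment from [y] to [x], composing with [L] gives a real function of one variable, so
    directional derivatives suffice. The intermediate point depends on [L], and the estimate is left
    inside [L]. *)
Lemma functional_mean_value (G : V -> W) (L : {linear W -> R^o}) (k l : R) :
  (forall w, `|L w| <= l * `|w|) -> (forall x v, derivable G x v) ->
  (forall x v, `|'D_v G x| <= k * `|v|) -> 0 <= l ->
  forall x y, `|L (G x - G y)| <= l * (k * `|x - y|).
Proof.
move=> Ll dG Gk l0 x y; pose v := x - y.
pose g (t : R) : R := L (G (t *: v + y)).
have dg (t : R) : is_derive t (1 : R) g (L ('D_v G (t *: v + y))).
  have [dLG DLG] := derivable_functional Ll (dG (t *: v + y) v).
  have E : (fun h : R => h^-1 *: ((g \o shift t) (h *: 1) - g t)) =
     (fun h => h^-1 *: ((L \o G \o shift (t *: v + y)) (h *: v) - (L \o G) (t *: v + y))).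
    apply/funext => h; congr (_ *: (_ - _)); rewrite /g /=.
    by rewrite scalerDl addrA /GRing.scale/= mulr1.
  by apply: DeriveDef; rewrite /derivable /derive E.
have [|t _] := @MVT_segment R g _ 0 1 ler01 (fun t _ => dg t).
  by apply: derivable_within_continuous => t _; exact: (@ex_derive _ _ _ _ _ _ _ (dg t)).
rewrite subr0 mulr1 /g scale1r scale0r add0r subrK -linearB => ->.
by rewrite (le_trans (Ll _))// ler_wpM2l.
Qed.

End functional_mean_value.

(** * Saddle-point problems in an abstract inner product space *)

Section saddle_point.
Context (R : realType) (H U : normedModType R) (ip : H -> H -> R).
Hypotheses (ip_scalar : forall z, scalar (ip^~ z))
  (ipC : forall x y, ip x y = ip y x) (ip_norm : forall x, ip x x = `|x| ^+ 2).

Let ipP a x y z : ip (a *: x + y) z = a * ip x z + ip y z.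
Proof. exact: ip_scalar. Qed.

Let ipD x y z : ip (x + y) z = ip x z + ip y z.
Proof. by have := ipP 1 x y z; rewrite scale1r mul1r. Qed.

Let ip0 z : ip 0 z = 0.
Proof. by apply: (addrI (ip 0 z)); rewrite -ipD !addr0. Qed.

Let ipZ a x z : ip (a *: x) z = a * ip x z.
Proof. by have := ipP a x 0 z; rewrite !addr0 ip0 addr0. Qed.

Let ipB x y z : ip (x - y) z = ip x z - ip y z.
Proof. by rewrite ipD -scaleN1r ipZ mulN1r. Qed.

Let ip_scalarr z : scalar (ip z).
Proof. by move=> a x y; rewrite ipC ipP !(ipC _ z). Qed.

(** Cauchy-Schwarz: the squared norm of [|y| x - |x| y] expands to [2 |x| |y| (|x| |y| - ip x y)],
    which is therefore nonnegative. *)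
Lemma ip_le_norm x y : ip x y <= `|x| * `|y|.
Proof.
have [->|x0] := eqVneq x 0; first by rewrite ip0 normr0 mul0r.
have nx : 0 < `|x| by rewrite normr_gt0.
have [->|y0] := eqVneq y 0; first by rewrite ipC ip0 normr0 mulr0.
have ny : 0 < `|y| by rewrite normr_gt0.
have := ip_norm (`|y| *: x - `|x| *: y).
rewrite ipB !(ipC _ (_ - _)) !ipB !ipZ !(ipC _ (_ *: _)) !ipZ !ip_norm (ipC y x) => E.
have : 0 <= `|(`|y| *: x - `|x| *: y)| ^+ 2 by rewrite exprn_ge0.
rewrite -E => {}E.
have : 0 <= (`|x| * `|y|) * (`|x| * `|y| - ip x y) by nra.
by rewrite pmulr_rge0 ?mulr_gt0// subr_ge0.
Qed.

Lemma normr_ip_le x y : `|ip x y| <= `|x| * `|y|.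
Proof.
by rewrite ler_norml ip_le_norm andbT lerNl -mulN1r -ipZ scaleN1r -(normrN x) ip_le_norm.
Qed.

Lemma ip_eqP x y : (forall z, ip x z = ip y z) -> x = y.
Proof.
move=> xy; apply/subr0_eq/eqP; rewrite -normr_eq0 -sqrf_eq0 -ip_norm.
by rewrite ipB xy subrr.
Qed.

Context (B : {linear U -> H}) (Uh : set U) (k m M : R).
Hypotheses (Uh_linear : forall a u v, Uh u -> Uh v -> Uh (a *: u + v))
  (B_below : forall u, `|u| <= k * `|B u|) (m_gt0 : 0 < m).

(** The first equation is posed in [H] itself; by [ip_eqP] this amounts to testing it with every
    element of [H]. *)
Definition saddle_solution (A : {linear H -> H}) (f : H) (ru : H * U) : Prop :=
  [/\ Uh ru.2, A ru.1 + B ru.2 = f & forall wh, Uh wh -> ip (B wh) ru.1 = 0].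

Implicit Types A : {linear H -> H}.

Definition coercive A := forall v, m * `|v| ^+ 2 <= ip (A v) v.

(** Test the first equation with the residual: the constraint removes the term in [B], and after
    coercivity and Cauchy-Schwarz one factor [|r|] cancels. *)
Lemma saddle_residual_le A f ru : coercive A -> saddle_solution A f ru ->
  `|ru.1| <= m^-1 * `|f|.
Proof.
case: ru => r u cA [/= Uu rf Br].
have : m * `|r| ^+ 2 <= `|f| * `|r|.
  apply: le_trans (cA r) _; apply: le_trans (ip_le_norm f r).
  by rewrite -rf ipD Br// addr0.
have [->|r0] := eqVneq r 0; first by rewrite normr0 mulr_ge0// invr_ge0 ltW.
by rewrite expr2 mulrA ler_pM2r ?normr_gt0// mulrC -ler_pdivlMr// mulrC.
Qed.

(** Since [B u = f - A r], the residual estimate bounds [B u], and [B_below] carries the bound over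
    to [u]. *)
Lemma saddle_state_le A f ru : coercive A -> (forall v, `|A v| <= M * `|v|) ->
  0 <= k -> 0 <= M ->
  saddle_solution A f ru -> `|ru.2| <= k * (1 + M * m^-1) * `|f|.
Proof.
move=> cA AM k0 M0 sol; have := saddle_residual_le cA sol.
case: ru sol => r u [/= Uu rf Br] rle.
apply: le_trans (B_below u) _; rewrite -mulrA ler_wpM2l//.
have -> : B u = f - A r by rewrite -rf addrC addKr.
rewrite mulrDl mul1r (le_trans (ler_normB _ _))// lerD2l.
by rewrite (le_trans (AM r))// -mulrA ler_wpM2l.
Qed.

Lemma saddle_linear A a f g p q : saddle_solution A f p -> saddle_solution A g q ->
  saddle_solution A (a *: f + g) (a *: p + q).
Proof.
case: p q => [r u] [s v] [/= Uu rf Br] [/= Uv sg Bs]; split => /=.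
- exact: Uh_linear.
- by rewrite !linearP -rf -sg scalerDr addrACA.
- by move=> w Uw; rewrite ip_scalarr/= Br// Bs// mulr0 addr0.
Qed.

(** The difference of two solutions has zero data, so its residual vanishes; then so does its image
    under [B], and [B_below] forces the state to vanish. *)
Lemma saddle_unique A f p q : coercive A ->
  saddle_solution A f p -> saddle_solution A f q -> p = q.
Proof.
move=> cA sp sq; have := saddle_linear (-1) sq sp.
rewrite !scaleN1r ![- _ + _]addrC subrr => sol.
have := saddle_residual_le cA sol; rewrite normr0 mulr0 normr_le0 => /eqP r0.
have [_ + _] := sol; rewrite r0 linear0 add0r => u0.
have := B_below (p - q).2; rewrite u0 normr0 mulr0 normr_le0 => /eqP {}u0.
apply/subr0_eq; case: (p - q) r0 u0 => r u /= -> ->; reflexivity.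
Qed.

(** Eliminating [r = N (f - B u)] turns the constraint into Galerkin orthogonality for the form
    [ip (N x) y]. When [N] divides by the weight, this is the weighted least-squares system. *)
Lemma saddle_exists A N f : coercive A -> (forall v, A (N v) = v) ->
  finite_dim_subspace Uh -> exists ru, saddle_solution A f ru.
Proof.
move=> cA AN [n [e UhE]].
have Ainj v w : A v = A w -> v = w.
  move=> vw; apply/subr0_eq/eqP; rewrite -normr_eq0 -sqrf_eq0 eq_le sqr_ge0 andbT.
  rewrite -(ler_pM2l m_gt0) mulr0; have := cA (v - w).
  by rewrite linearB/= vw subrr ip0.
(* Coercivity makes [A] injective, so its right inverse [N] inherits linearity. *)
have Nlin : linear N by move=> a x y; apply: Ainj; rewrite AN linearP/= !AN.
have [|||c cP] := @galerkin_exists R H (fun x y => ip (N x) y) _ _ _ n (B \o e) f.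
- by move=> y a u v; rewrite Nlin ipP.
- by move=> x; exact: ip_scalarr.
(* Definiteness: as [x = A (N x)], the form at [(x, x)] is at least [m |N x| ^ 2]. *)
- move=> x x0; suff : N x = 0 by move=> /(congr1 A); rewrite AN linear0.
  have := cA (N x); rewrite AN ipC x0 => xx; apply/eqP.
  rewrite -normr_eq0 -sqrf_eq0 eq_le sqr_ge0 andbT.
  by rewrite -(ler_pM2l m_gt0) mulr0.
exists (N (f - \sum_(j < n) c j *: (B \o e) j), \sum_(j < n) c j *: e j).
have BE d : B (\sum_(j < n) d j *: e j) = \sum_(j < n) d j *: (B \o e) j.
  by rewrite linear_sum; apply: eq_bigr => j _; rewrite linearZ.
split=> /=; first by rewrite UhE; exists c.
  by rewrite AN BE subrK.
move=> w; rewrite UhE => -[d ->]; rewrite BE.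
pose g : H -> R^o := ip^~ (N (f - \sum_(j < n) c j *: (B \o e) j)).
have gS (F : 'I_n -> H) : g (\sum_(j < n) F j) = \sum_(j < n) g (F j).
  exact: (big_morph g (fun x y => ipD x y _) (ip0 _)).
rewrite -[LHS]/(g _) gS big1// => j _.
by rewrite /g ipZ ipC cP mulr0.
Qed.

End saddle_point.

(** * Dependence of the saddle-point solution on the parameter *)

Section parametric_saddle_point.
Context (R : realType) (X W H U : normedModType R) (ip : H -> H -> R).
Hypotheses (ip_scalar : forall z, scalar (ip^~ z))
  (ipC : forall x y, ip x y = ip y x) (ip_norm : forall x, ip x x = `|x| ^+ 2).
Context (B : {linear U -> H}) (Uh : set U) (k m M : R).
Hypotheses (Uh_linear : forall a u v, Uh u -> Uh v -> Uh (a *: u + v))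
  (B_below : forall u, `|u| <= k * `|B u|)
  (k_ge0 : 0 <= k) (m_gt0 : 0 < m) (M_ge0 : 0 <= M).
(** Stands for multiplication of [L^2] by functions in [L^infty]; only bilinearity and the product
    bound are kept. *)
Context (mul : W -> {linear H -> H}).
Hypotheses (mulP : forall a w1 w2 v, mul (a *: w1 + w2) v = a *: mul w1 v + mul w2 v)
  (mul_le : forall w v, `|mul w v| <= `|w| * `|v|).
Context (w : X -> W) (sol : X -> H -> H * U).
Hypotheses (w_coercive : forall x, coercive ip m (mul (w x)))
  (w_le : forall x v, `|mul (w x) v| <= M * `|v|)
  (solP : forall x f, saddle_solution ip B Uh (mul (w x)) f (sol x f)).

Let K := k * (1 + M * m^-1).

Let K_ge0 : 0 <= K.
Proof. by rewrite mulr_ge0// addr_ge0// mulr_ge0// invr_ge0 ltW. Qed.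

Let m_inv_ge0 : 0 <= m^-1. Proof. by rewrite invr_ge0 ltW. Qed.

Lemma sol_residual_le x f : `|(sol x f).1| <= m^-1 * `|f|.
Proof. exact: (saddle_residual_le ip_scalar ipC ip_norm m_gt0 (w_coercive x)). Qed.

Lemma sol_state_le x f : `|(sol x f).2| <= K * `|f|.
Proof.
exact: (saddle_state_le ip_scalar ipC ip_norm B_below m_gt0 (w_coercive x) (w_le x)).
Qed.

Lemma sol_unique x f ru : saddle_solution ip B Uh (mul (w x)) f ru -> ru = sol x f.
Proof.
move=> sru.
exact: (saddle_unique ip_scalar ipC ip_norm Uh_linear B_below m_gt0 (w_coercive x) sru).
Qed.

(** [sol x] is a choice made for each datum separately; uniqueness turns superposition into
    linearity. *)
Lemma sol_linear x : linear (sol x).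
Proof.
by move=> a f g; apply/esym/sol_unique/(saddle_linear ip_scalar ipC Uh_linear).
Qed.

Let solL x : {linear H -> (H * U)%type} :=
  HB.pack (sol x) (GRing.isLinear.Build R H (H * U)%type *:%R _ (@sol_linear x)).

Lemma sol_continuous x : continuous (sol x).
Proof.
apply: (@linear_le_continuous _ _ _ (solL x) (Num.max m^-1 K)) => f.
rewrite [leLHS]prod_normE ge_max; apply/andP; split.
  by rewrite (le_trans (sol_residual_le x f))// ler_wpM2r// le_max lexx.
by rewrite (le_trans (sol_state_le x f))// ler_wpM2r// le_max lexx orbT.
Qed.

Let mulBl w1 w2 v : mul (w1 - w2) v = mul w1 v - mul w2 v.
Proof. by rewrite -scaleN1r addrC mulP scaleN1r addrC. Qed.

Let mulZl a w1 v : mul (a *: w1) v = a *: mul w1 v.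
Proof.
rewrite -[a *: w1]addr0 mulP; suff -> : mul 0 v = 0 by rewrite addr0.
by rewrite -(subrr 0) mulBl subrr.
Qed.

Let mulNl w1 v : mul (- w1) v = - mul w1 v.
Proof. by rewrite -scaleN1r mulZl scaleN1r. Qed.

(* Subtracting the two problems and moving the difference of the weights to the
   right-hand side leaves a problem with the weight at x. *)
Lemma sol_sub x y f g : sol x f - sol y g =
  sol x (f - g - mul (w x - w y) (sol y g).1).
Proof.
apply: sol_unique; case: (solP x f) (solP y g) => [Uf Ef Bf] [Ug Eg Bg]; split.
- by rewrite /= -scaleN1r addrC; exact: Uh_linear.
- rewrite /= !linearB/= mulBl -[X in _ = X - _ - _]Ef -[X in _ = _ - X - _]Eg.
  rewrite opprD opprB -[RHS]addrA [in RHS](addrACA (- _)) addNr add0r.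
  by rewrite [in RHS](addrC (- _)) addrACA.
- move=> v Uv; rewrite ipC /= -scaleN1r addrC ip_scalar.
  by rewrite !(ipC _ (B v)) Bf// Bg// mulr0 addr0.
Qed.

Variable f : H.

Let r x := (sol x f).1.
Let state x := (sol x f).2.

(** The solution operator is frozen at [x] and only the data involve [y], the form suited to the
    limit [y -> x]. *)
Let sol_sub_same x y : sol y f - sol x f = sol x (- mul (w y - w x) (r y)).
Proof.
rewrite -opprB sol_sub subrr sub0r -[w y - _]opprB mulNl opprK.
by rewrite -[LHS]/(- solL x _) linearN opprK.
Qed.

Lemma sol_residual_sub_le x y : `|r y - r x| <= m^-1 * `|mul (w y - w x) (r y)|.
Proof.
rewrite -[leLHS]/(`|(sol y f - sol x f).1|) sol_sub_same.
by rewrite (le_trans (sol_residual_le _ _))// normrN.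
Qed.

(** The difference quotient is exactly a fixed continuous linear map applied to the product of the
    quotient of [w] and the residual at the shifted point. It remains to pass to the limit in that
    product. *)
Lemma is_derive_state x v : derivable w x v ->
  is_derive x v state (sol x (- mul ('D_v w x) (r x))).2.
Proof.
move=> dw.
pose q (h : R) : W := h^-1 *: ((w \o shift x) (h *: v) - w x).
pose rh (h : R) : H := r (h *: v + x).
have qw : q @ 0^' --> 'D_v w x by exact: dw.
pose S (g : H) : U := (sol x (- g)).2.
have S_lin : linear S.
  move=> a g1 g2; rewrite /S (_ : - _ = a *: (- g1) + - g2) ?sol_linear//.
  by rewrite scalerN opprD.
pose L : {linear H -> U} := HB.pack S (GRing.isLinear.Build R H U *:%R _ S_lin).
have cL : continuous L.
  apply: (@linear_le_continuous _ _ _ L K) => g.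
  by rewrite (le_trans (sol_state_le x _))// normrN.
have qE : (fun h : R => h^-1 *: ((state \o shift x) (h *: v) - state x)) =
    L \o (fun h => mul (q h) (rh h)).
  apply/funext => h /=; rewrite /S /q mulZl -scalerN.
  rewrite -[sol x _]/(solL x _) linearZ_LR.
  exact: (congr1 (fun p : H * U => h^-1 *: p.2) (sol_sub_same x (h *: v + x))).
have rle h : `|rh h - r x| <= m^-1 * (`|h| * (`|q h| * (m^-1 * `|f|))).
  rewrite (le_trans (sol_residual_sub_le _ _))// ler_wpM2l//.
  have -> : w (h *: v + x) - w x = h *: q h.
    have [->|h0] := eqVneq h 0; first by rewrite !scale0r add0r subrr.
    by rewrite /q scalerA mulfV// scale1r.
  rewrite mulZl normrZ ler_wpM2l// (le_trans (mul_le _ _))// ler_wpM2l//.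
  exact: sol_residual_le.
have c : (fun h => mul (q h) (rh h)) @ 0^' --> mul ('D_v w x) (r x).
  (* In the first term a convergent factor meets bounded residuals; in the second the fixed
     derivative meets residuals that converge by [rle], because [q] stays bounded near 0. *)
  have rhE h : mul (q h) (rh h) - mul ('D_v w x) (r x) =
      mul (q h - 'D_v w x) (rh h) + mul ('D_v w x) (rh h - r x).
    by rewrite mulBl linearB addrA subrK.
  pose bound h := `|q h - 'D_v w x| * (m^-1 * `|f|) +
    `|'D_v w x| * (m^-1 * (`|h| * (`|q h| * (m^-1 * `|f|)))).
  have q0 : `|q h - 'D_v w x| @[h --> 0^'] --> (0 : R).
    by rewrite -[X in _ --> X](@normr0 R W); apply: cvg_norm; apply/subr_cvg0; exact: qw.
  have h0 : `|h| @[h --> (0 : R)^'] --> (0 : R).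
    rewrite -[X in _ --> X](@normr0 R R).
    by apply: cvg_norm; apply: cvg_within_filter; exact: cvg_id.
  have bound0 : bound h @[h --> 0^'] --> (0 : R).
    rewrite [X in _ --> X](_ : 0 = 0 * (m^-1 * `|f|) +
      `|'D_v w x| * (m^-1 * (0 * (`|'D_v w x| * (m^-1 * `|f|))))); last first.
      by rewrite !(mul0r, mulr0) addr0.
    by apply: cvgD; [apply: cvgM q0 (cvg_cst _)|apply: cvgM (cvg_cst _) (cvgM
      (cvg_cst _) (cvgM h0 (cvgM (cvg_norm qw) (cvg_cst _))))].
  apply/subr_cvg0/norm_cvg0P.
  apply: (@squeeze_cvgr _ _ _ _ (cst 0) bound) => //; last exact: cvg_cst.
  apply: nearW => h; rewrite normr_ge0/= rhE (le_trans (ler_normD _ _))//.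
  apply: lerD.
    by rewrite (le_trans (mul_le _ _))// ler_wpM2l// sol_residual_le.
  by rewrite (le_trans (mul_le _ _))// ler_wpM2l.
have cS : (fun h : R => h^-1 *: ((state \o shift x) (h *: v) - state x)) @ 0^' -->
    S (mul ('D_v w x) (r x)).
  by rewrite qE; apply: continuous_cvg; [exact: cL|exact: c].
apply: DeriveDef; last exact/cvg_lim.
by apply/cvg_ex; exists (S (mul ('D_v w x) (r x))).
Qed.

Context (kd kL : R).
Hypotheses (kd_ge0 : 0 <= kd)
  (w_derivable : forall x v, derivable w x v)
  (dw_le : forall x v, `|'D_v w x| <= kd * `|v|)
  (dw_sub_le : forall x y v, `|'D_v w x - 'D_v w y| <= kL * `|x - y| * `|v|).

(* Testing with [mul (w x - w y) z] itself reduces this to the mean value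
   theorem for a real-valued function. *)
Lemma mul_weight_sub_le x y z : `|mul (w x - w y) z| <= kd * `|x - y| * `|z|.
Proof.
pose t := mul (w x - w y) z.
have L_lin : linear ((fun u => ip (mul u z) t) : W -> R^o).
  by move=> a u1 u2; rewrite mulP ip_scalar.
pose L : {linear W -> R^o} := HB.pack ((fun u => ip (mul u z) t) : W -> R^o)
  (GRing.isLinear.Build R W R^o *:%R _ L_lin).
rewrite -/t; have [->|t0] := eqVneq t 0; first by rewrite normr0 !mulr_ge0.
have L_le u : `|L u| <= `|z| * `|t| * `|u|.
  rewrite (le_trans (normr_ip_le ip_scalar ipC ip_norm _ _))// mulrAC.
  by rewrite ler_wpM2r// mulrC mul_le.
have := functional_mean_value L_le w_derivable dw_le (mulr_ge0 _ _) x y.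
rewrite [L _]ip_norm ger0_norm ?exprn_ge0// => /(_ (normr_ge0 _) (normr_ge0 _)).
by rewrite expr2 mulrAC ler_pM2r ?normr_gt0// mulrC.
Qed.

Lemma derive_state x v : 'D_v state x = (sol x (- mul ('D_v w x) (r x))).2.
Proof. exact: (@derive_val _ _ _ _ _ _ _ (is_derive_state (@w_derivable x v))). Qed.

Let R1 := m^-1 * `|f|.

Let R1_ge0 : 0 <= R1. Proof. by rewrite mulr_ge0. Qed.

Let mul_dw_le x v : `|mul ('D_v w x) (r x)| <= kd * R1 * `|v|.
Proof.
by rewrite (le_trans (mul_le _ _))// mulrAC ler_pM ?dw_le ?sol_residual_le.
Qed.

Lemma derive_state_le x v : `|'D_v state x| <= K * (kd * R1) * `|v|.
Proof.
rewrite derive_state (le_trans (sol_state_le _ _))// normrN -mulrA.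
by rewrite ler_wpM2l.
Qed.

Lemma gateaux_differentiable_state (dw_linear : forall x, linear (gateaux w x)) :
  gateaux_differentiable state.
Proof.
move=> x.
have D_lin : linear (gateaux state x).
  move=> a u v; rewrite /gateaux !derive_state.
  have -> : 'D_(a *: u + v) w x = a *: 'D_u w x + 'D_v w x by exact: dw_linear.
  by rewrite mulP opprD -scalerN sol_linear.
split=> //; first by move=> v; exact: (@ex_derive _ _ _ _ _ _ _
  (is_derive_state (@w_derivable x v))).
pose L : {linear X -> U} := HB.pack (gateaux state x)
  (GRing.isLinear.Build R X U *:%R _ D_lin).
exact: (@linear_le_continuous _ _ _ L _ (derive_state_le x)).
Qed.

(** Both derivatives solve saddle-point problems, so [sol_sub] reduces their difference to three
    data terms: the change of the derivative of [w], giving [kL]; the change of the residual; and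
    the change of the weight acting on the residual of the derivative problem at [y]. Each of the
    last two contributes [kd * (m^-1 * kd)]. *)
Lemma derive_state_sub_le x y v : `|'D_v state x - 'D_v state y| <=
  K * ((kL + (kd + kd) * (m^-1 * kd)) * R1) * `|x - y| * `|v|.
Proof.
rewrite !derive_state.
rewrite -[leLHS]/(`|(sol x (- mul ('D_v w x) (r x)) -
  sol y (- mul ('D_v w y) (r y))).2|).
rewrite sol_sub (le_trans (sol_state_le _ _))// -!(mulrA K) ler_wpM2l//.
set g := - mul _ (r y); set e := `|x - y|; set n := `|v|.
have rxy : `|r x - r y| <= m^-1 * kd * e * R1.
  rewrite distrC (le_trans (sol_residual_sub_le _ _))// -!mulrA ler_wpM2l//.
  rewrite (le_trans (mul_weight_sub_le _ _ _))// distrC mulrA.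
  by rewrite ler_wpM2l ?mulr_ge0// sol_residual_le.
have -> : - mul ('D_v w x) (r x) - g - mul (w x - w y) (sol y g).1 =
    - (mul ('D_v w x - 'D_v w y) (r x) + mul ('D_v w y) (r x - r y)
       + mul (w x - w y) (sol y g).1).
  rewrite (mulBl (derive w x v)) (linearB (mul (derive w y v)))/= addrA subrK.
  by rewrite opprD opprB /g opprK [RHS]addrC addrC [in LHS](addrC (- _)).
rewrite normrN.
have b1 : `|mul ('D_v w x - 'D_v w y) (r x)| <= kL * e * n * R1.
  by rewrite (le_trans (mul_le _ _))// ler_pM ?dw_sub_le ?sol_residual_le.
have b2 : `|mul ('D_v w y) (r x - r y)| <= (kd * n) * (m^-1 * kd * e * R1).
  by rewrite (le_trans (mul_le _ _))// ler_pM ?dw_le.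
have b3 : `|mul (w x - w y) (sol y g).1| <= kd * e * (m^-1 * (kd * R1 * n)).
  rewrite (le_trans (mul_weight_sub_le _ _ _))// ler_wpM2l ?mulr_ge0//.
  by rewrite (le_trans (sol_residual_le _ _))// ler_wpM2l// normrN.
rewrite (le_trans (ler_normD _ _))// (le_trans (lerD (ler_normD _ _) b3))//.
rewrite (le_trans (lerD (lerD b1 b2) (lexx _)))//.
by rewrite le_eqVlt; apply/orP; left; apply/eqP; rewrite -/R1; ring.
Qed.

End parametric_saddle_point.

(** * Multiplication of [L^2] by bounded functions *)

Section bounded_multiplication.
Context d (T : measurableType d) (R : realType).
Variable mu : {measure set T -> \bar R}.
Notation L2 := (LspaceType2 mu).
Notation Loo := (LspaceType mu (leey 1%E)).

(** Writing the right-hand side as the norm of [c v] leaves an almost everywhere comparison of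
    integrands. [g] is a plain function so that reciprocals of weights are covered as well. *)
Lemma Lfun_bounded_mul (g v : T -> R) (c : R) :
  measurable_fun setT g -> (\forall x \ae mu, `|g x| <= c) -> 0 <= c ->
  v \in Lfun mu 2%:E -> g \* v \in Lfun mu 2%:E /\
  ('N[mu]_2%:E[EFin \o (g \* v)%R] <= c%:E * 'N[mu]_2%:E[EFin \o v])%E.
Proof.
move=> mg gc c0 Lv; pose f : LfunType mu (lee1n 2) := Lfun_Sub (lee1n 2) Lv.
have mv : measurable_fun setT v := @measurable_funPT _ _ _ _ f.
have mgv : measurable_fun setT (g \* v) by exact: measurable_funM.
have le : ('N[mu]_2%:E[EFin \o (g \* v)%R] <= c%:E * 'N[mu]_2%:E[EFin \o v])%E.
  have := LnormZ f c; rewrite ger0_norm// => <-.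
  have mpow (u : T -> R) : measurable_fun setT u ->
      measurable_fun setT (fun x => `|(EFin \o u) x| `^ 2)%E.
    move=> mea_u; apply: (@measurableT_comp _ _ _ _ _ _ (fun x : \bar R => x `^ 2)%E
      _ (fun x => `|(EFin \o u) x|%E)).
      exact: measurable_poweR.
    by apply: measurableT_comp => //; exact: measurableT_comp.
  rewrite unlock; apply: gt0_ler_poweR.
  - by rewrite invr_ge0.
  - by rewrite in_itv/= leey integral_ge0// => x _; exact: poweR_ge0.
  - by rewrite in_itv/= leey integral_ge0// => x _; exact: poweR_ge0.
  apply: ae_ge0_le_integral => //.
  - by move=> x _; exact: poweR_ge0.
  - exact: mpow.
  - by move=> x _; exact: poweR_ge0.
  - by apply: mpow; apply: measurable_funM.
  apply: filterS gc => x gxc _ /=; rewrite lee_fin ge0_ler_powR ?nnegrE//.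
  by rewrite !normrM (ger0_norm c0) ler_wpM2r.
split=> //; apply/andP; split; rewrite inE/=; first exact: mgv.
rewrite /finite_norm (le_lt_trans le)// lte_mul_pinfty//.
exact: (@Lfunction_finite _ _ _ _ _ (lee1n 2) f).
Qed.

Lemma Linfty_norm_ge (w : Loo) : \forall x \ae mu, `|Lspace_fun w x| <= `|w|.
Proof.
have wfin : ('N[mu]_+oo[EFin \o Lspace_fun w] \is a fin_num)%E.
  by rewrite ge0_fin_numE ?Lnorm_ge0//; exact: (@Lebesgue_finite _ _ _ _ _ _ w).
have nE : (`|w|%:E = 'N[mu]_+oo[EFin \o Lspace_fun w])%E by rewrite -(fineK wfin).
(* The norm is an essential supremum only for a nonzero measure; for the zero measure every property
   holds almost everywhere. *)
have [mu0|mu0] := ltP 0%E (mu setT).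
  apply: filterS (ess_sup_ge mu (abse \o (EFin \o Lspace_fun w))) => x.
  suff <- : (`|w|%:E = ess_sup mu (abse \o (EFin \o Lspace_fun w)))%E.
    by rewrite /= lee_fin.
  by rewrite nE unlock mu0.
exists setT; split => //; apply/eqP; rewrite eq_le mu0/=; exact: measure_ge0.
Qed.

Let mul_subproof (w : Loo) (v : L2) :
  Lspace_fun w \* Lspace_fun v \in Lfun mu 2%:E.
Proof.
exact: (Lfun_bounded_mul (measurable_Lspace_fun w) (Linfty_norm_ge w)
  (normr_ge0 _) (Lspace_funP v)).1.
Qed.

Definition Lmul (w : Loo) (v : L2) : L2 :=
  Lspace_class (Lfun_Sub (lee1n 2) (mul_subproof w v)).

Lemma LmulE w v : \forall x \ae mu,
  Lspace_fun (Lmul w v) x = Lspace_fun w x * Lspace_fun v x.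
Proof.
apply: filterS (Lspace_classE (Lfun_Sub (lee1n 2) (mul_subproof w v))) => x.
exact.
Qed.

Let Lmul_linear w : linear (Lmul w).
Proof.
move=> a u v; apply: Lspace_ext; near=> x => _.
rewrite (near (LmulE w (a *: u + v)) x)//.
rewrite (near (Lspace_addE (a *: u) v) x)// (near (Lspace_scaleE a u) x)//.
rewrite (near (Lspace_addE (a *: Lmul w u) (Lmul w v)) x)//.
rewrite (near (Lspace_scaleE a (Lmul w u)) x)//.
rewrite (near (LmulE w u) x)// (near (LmulE w v) x)//.
by rewrite mulrDr mulrCA.
Unshelve. all: by end_near. Qed.

HB.instance Definition _ w := GRing.isLinear.Build R L2 L2 *:%R (Lmul w) (@Lmul_linear w).

Lemma Lmul_linearl a w1 w2 v : Lmul (a *: w1 + w2) v = a *: Lmul w1 v + Lmul w2 v.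
Proof.
apply: Lspace_ext; near=> x => _.
rewrite (near (LmulE (a *: w1 + w2) v) x)//.
rewrite (near (Lspace_addE (a *: w1) w2) x)// (near (Lspace_scaleE a w1) x)//.
rewrite (near (Lspace_addE (a *: Lmul w1 v) (Lmul w2 v)) x)//.
rewrite (near (Lspace_scaleE a (Lmul w1 v)) x)//.
rewrite (near (LmulE w1 v) x)// (near (LmulE w2 v) x)//.
by rewrite mulrDl mulrA.
Unshelve. all: by end_near. Qed.

(** Any almost everywhere bound is allowed, so that [varpi_max] serves directly as operator
    bound. *)
Lemma Lmul_le_ae w v c : 0 <= c -> (\forall x \ae mu, `|Lspace_fun w x| <= c) ->
  `|Lmul w v| <= c * `|v|.
Proof.
move=> c0 wc.
have [Lwv le] := Lfun_bounded_mul (measurable_Lspace_fun w) wc c0 (Lspace_funP v).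
have fin (f : LfunType mu (lee1n 2)) : ('N[mu]_2%:E[EFin \o f] \is a fin_num)%E.
  by rewrite ge0_fin_numE ?Lnorm_ge0//; exact: Lfunction_finite.
rewrite -lee_fin EFinM -[`|v|]/(fine ('N[mu]_2%:E[EFin \o Lspace_fun v])%E).
rewrite (fineK (fin (Lspace_repr v))) (le_trans _ le)//.
rewrite -[`|_|]/(fine ('N[mu]_2%:E[EFin \o Lspace_fun (Lmul w v)])%E).
rewrite (eq_Lnorm_ae (lee1n 2) (measurable_Lspace_fun _) _ (Lspace_classE _)).
  by rewrite (fineK (fin _)).
exact: (@measurable_funPT _ _ _ _ (Lfun_Sub (lee1n 2) Lwv)).
Qed.

Lemma Lmul_le w v : `|Lmul w v| <= `|w| * `|v|.
Proof. by apply: Lmul_le_ae => //; exact: Linfty_norm_ge. Qed.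

(** Division by the weight is the right inverse that [saddle_exists] asks for. *)
Lemma Lmul_surjective w m : 0 < m -> (\forall x \ae mu, m <= Lspace_fun w x) ->
  exists N : L2 -> L2, forall v, Lmul w (N v) = v.
Proof.
move=> m0 mw; pose g x := Lspace_fun w x `^ (-1).
(* The real power is measurable on the whole line and agrees with the reciprocal where the weight is
   positive, hence almost everywhere. *)
have mg : measurable_fun setT g.
  apply: (measurableT_comp (measurable_powR _)).
  exact: measurable_Lspace_fun.
have gE : \forall x \ae mu, g x = (Lspace_fun w x)^-1.
  by apply: filterS mw => x mwx; rewrite /g powR_inv1// (le_trans _ mwx)// ltW.
have gm : \forall x \ae mu, `|g x| <= m^-1.
  apply: filterS2 mw gE => x mwx ->; have w0 := lt_le_trans m0 mwx.
  by rewrite ger0_norm ?lef_pV2// invr_ge0 ltW.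
have m0' : 0 <= m^-1 by rewrite invr_ge0 ltW.
pose N (v : L2) : L2 := Lspace_class (Lfun_Sub (lee1n 2)
  (Lfun_bounded_mul mg gm m0' (Lspace_funP v)).1).
exists N => v; apply: Lspace_ext; near=> x => _.
rewrite (near (LmulE w (N v)) x)//.
have -> : Lspace_fun (N v) x = g x * Lspace_fun v x.
  near: x; apply: filterS (Lspace_classE (Lfun_Sub (lee1n 2)
    (Lfun_bounded_mul mg gm m0' (Lspace_funP v)).1)) => x /(_ Logic.I).
  by [].
rewrite (near gE x)// mulrA mulfV ?mul1r// gt_eqF//.
by rewrite (lt_le_trans m0)// (near mw x).
Unshelve. all: by end_near. Qed.

End bounded_multiplication.

(** * The [L^2] inner product on classes of functions *)

Section L2_inner_product.
Context (R : realType) (d : nat) (Omega : bounded_domain R d).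
Notation mu := (lebesgue_on Omega).
Implicit Types u v w : L2 Omega.

Lemma L2dotC (u v : 'rV[R]_d -> R) : L2dot Omega u v = L2dot Omega v u.
Proof. by apply: eq_Rintegral => x _; rewrite mulrC. Qed.

Lemma ae_eq_Rintegral (f g : 'rV[R]_d -> R) :
  measurable_fun setT f -> measurable_fun setT g ->
  (\forall x \ae mu, f x = g x) -> \int[mu]_x f x = \int[mu]_x g x.
Proof.
move=> mf mg fg; congr fine; apply: ae_eq_integral => //.
- exact/measurable_EFinP.
- exact/measurable_EFinP.
- by apply: filterS fg => x ->.
Qed.

Let mdot u v : measurable_fun setT (fun x => Lspace_fun u x * Lspace_fun v x).
Proof. by apply: measurable_funM; exact: measurable_Lspace_fun. Qed.

Let idot u v : mu.-integrable setT (EFin \o (fun x => Lspace_fun u x * Lspace_fun v x)).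
Proof. by apply/Lfun1_integrable; apply: Lfun2_mul_Lfun1; exact: Lspace_funP. Qed.

Lemma L2dot_scalar w : scalar ((fun u => L2dot Omega u w) : L2 Omega -> R).
Proof.
move=> a u v; rewrite /L2dot -(RintegralZl _ measurableT (idot u w)).
have iZ : mu.-integrable setT (EFin \o (fun x => a * (Lspace_fun u x * Lspace_fun w x))).
  rewrite (_ : _ \o _ = (fun x => a%:E * (Lspace_fun u x * Lspace_fun w x)%:E)%E).
    by apply: integrableZl => //; exact: idot.
  by apply/funext => x; rewrite /= EFinM.
rewrite -(RintegralD measurableT iZ (idot v w)).
apply: ae_eq_Rintegral; first exact: mdot.
  by apply: measurable_funD; [apply: measurable_funM => //|]; exact: mdot.
near=> x.
have -> : (a *: u + v : L2 Omega) x = Lspace_fun (a *: u) x + Lspace_fun v x.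
  by near: x; exact: Lspace_addE.
have -> : Lspace_fun (a *: u) x = a * Lspace_fun u x by near: x; exact: Lspace_scaleE.
by rewrite mulrDl mulrA.
Unshelve. all: by end_near. Qed.

(** Links the form [a], which integrates a pointwise product, to the operator [Lmul] on classes. *)
Lemma L2dot_Lmul (z : Linfty Omega) u v :
  L2dot Omega (fun x => z x * u x) v = L2dot Omega (Lmul z u) v.
Proof.
apply: ae_eq_Rintegral; last 2 first.
- exact: mdot.
- by apply: filterS (LmulE z u) => x <-.
apply: measurable_funM; last exact: measurable_Lspace_fun.
by apply: measurable_funM; exact: measurable_Lspace_fun.
Qed.

Lemma Lmul_coercive (z : Linfty Omega) m : (\forall x \ae mu, m <= Lspace_fun z x) ->
  coercive (fun u v => L2dot Omega u v) m (Lmul z).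
Proof.
move=> mz v; rewrite L2dot_normE -subr_ge0.
rewrite -(RintegralZl _ measurableT (idot v v)).
have iZ : mu.-integrable setT (EFin \o (fun x => m * (Lspace_fun v x * Lspace_fun v x))).
  rewrite (_ : _ \o _ = (fun x => m%:E * (Lspace_fun v x * Lspace_fun v x)%:E)%E).
    by apply: integrableZl => //; exact: idot.
  by apply/funext => x; rewrite /= EFinM.
rewrite -(RintegralB measurableT (idot (Lmul z v) v) iZ).
have mh : measurable_fun setT (fun x => Lspace_fun (Lmul z v) x * Lspace_fun v x -
    m * (Lspace_fun v x * Lspace_fun v x)).
  by apply: measurable_funB; [exact: mdot|apply: measurable_funM => //; exact: mdot].
(* The integrand [(z - m) v ^ 2] is nonnegative only almost everywhere; its absolute value is so at
   every point and has the same integral. *)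
rewrite (ae_eq_Rintegral mh (g := fun x => `|Lspace_fun (Lmul z v) x * Lspace_fun v x -
    m * (Lspace_fun v x * Lspace_fun v x)|)).
- exact: Rintegral_ge0.
- exact: measurableT_comp.
- apply: filterS2 mz (LmulE z v) => x mzx ->.
  by rewrite ger0_norm// -mulrA -mulrBl mulr_ge0 ?subr_ge0// -expr2 sqr_ge0.
Qed.

End L2_inner_product.

(** * Well-posedness of the mixed problem and regularity of its state operator *)

Theorem proposition3p1 (R : realType) (d : nat) (Omega : bounded_domain R d)
    (P : diff_expr R d) (bc : set (L2 Omega))
    (D : submodClosed (L2 Omega)) (B : {linear op_dom D -> L2 Omega})
    (Uh : set (graph_space B)) (f : L2 Omega)
    (varpi : L2 Omega -> Linfty Omega)
    (varpi_min varpi_max varpi_inf varpi_L : R)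
    (Hbc : boundary_condition bc)
    (HB : graph_operator P bc B)
    (HHilbert : complete_space (graph_space B))
    (HBinv : boundedly_invertible (B : graph_space B -> L2 Omega))
    (HUh : finite_dim_subspace Uh)
    (Hvarpi : gateaux_differentiable varpi)
    (Hwmin : 0 < varpi_min) (Hwmax : 0 < varpi_max) (Hwinf : 0 < varpi_inf) (HwL : 0 < varpi_L)
    (Hbounds : forall xi : L2 Omega,
       {ae lebesgue_on Omega, forall x, varpi_min <= varpi xi x <= varpi_max})
    (Hderiv : forall xi : L2 Omega, (opnorm (gateaux varpi xi) <= varpi_inf%:E)%E)
    (Hlip : forall xi1 xi2 : L2 Omega,
       (opnorm (fun eta => gateaux varpi xi1 eta - gateaux varpi xi2 eta)%R
          <= (varpi_L * `|xi1 - xi2|)%:E)%E) :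
  [/\ forall xi : L2 Omega,
        (exists alphah betah : R, [/\ 0 < alphah, 0 < betah,
           (alphah%:E <= inf_sup (Khat Uh) (Khat Uh) (form_a varpi xi))%E,
           [set v2 | Khat Uh v2 /\
              forall v1, Khat Uh v1 -> form_a varpi xi v1 v2 = 0] = [set 0] &
           (betah%:E <= inf_sup Uh setT (@form_b _ _ _ _ B))%E]) /\
        mixed_well_posed Uh varpi xi,
      [/\ forall xi : L2 Omega, Uh (state_operator Uh varpi f xi),
          exists C : R, forall xi : L2 Omega, `|state_operator Uh varpi f xi| <= C &
          gateaux_differentiable (state_operator Uh varpi f)] &
      (exists C : R, forall xi : L2 Omega,
         (opnorm (gateaux (state_operator Uh varpi f) xi) <= C%:E)%E) /\
      (exists L : R, forall xi1 xi2 : L2 Omega,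
         (opnorm (fun eta => gateaux (state_operator Uh varpi f) xi1 eta
                           - gateaux (state_operator Uh varpi f) xi2 eta)%R
            <= (L * `|xi1 - xi2|)%:E)%E)].
Proof.
pose ip := fun u v : L2 Omega => L2dot Omega u v.
have ip_scalar z : scalar (ip^~ z) := L2dot_scalar z.
have ipC x y : ip x y = ip y x by exact: L2dotC.
have ip_norm x : ip x x = `|x| ^+ 2 by rewrite L2dot_normE.
have ipD x y z : ip (x + y) z = ip x z + ip y z.
  by have := ip_scalar z 1 x y; rewrite scale1r mul1r.
(* The same map as [B], with its domain now carrying the graph norm. *)
pose Bg : {linear graph_space B -> L2 Omega} := HB.pack (B : graph_space B -> L2 Omega)
  (GRing.isLinear.Build R (graph_space B) (L2 Omega) *:%R _ (linearP B)).
have [k k0 B_below] := @boundedly_invertible_le R (graph_space B) (L2 Omega) Bg HBinv.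
have Uh_linear a u v : Uh u -> Uh v -> Uh (a *: u + v).
  have [n [e ->]] := HUh => -[c ->] [c' ->]; exists (fun i => a * c i + c' i).
  rewrite scaler_sumr -big_split; apply: eq_bigr => i _ /=.
  by rewrite scalerDl scalerA.
pose mul (w : Linfty Omega) : {linear L2 Omega -> L2 Omega} := Lmul w.
have mul_linear a w1 w2 v : mul (a *: w1 + w2) v = a *: mul w1 v + mul w2 v
  := Lmul_linearl a w1 w2 v.
have mul_le w v : `|mul w v| <= `|w| * `|v| := Lmul_le w v.
have w_min xi : \forall x \ae lebesgue_on Omega, varpi_min <= Lspace_fun (varpi xi) x.
  by apply: filterS (Hbounds xi) => x /andP[].
have w_coercive xi : coercive ip varpi_min (mul (varpi xi)) := Lmul_coercive (w_min xi).
have w_le xi v : `|mul (varpi xi) v| <= varpi_max * `|v|.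
  apply: Lmul_le_ae; first exact: ltW.
  apply: filterS (Hbounds xi) => x /andP[wx xw].
  by rewrite ger0_norm// (le_trans _ wx)// ltW.
have /choice[sol0 sol0P] : forall p : L2 Omega * L2 Omega,
    exists ru, saddle_solution ip Bg Uh (mul (varpi p.1)) p.2 ru.
  move=> [xi g]; have [N NK] := Lmul_surjective Hwmin (w_min xi).
  exact: (saddle_exists ip_scalar ipC Bg Hwmin g (w_coercive xi) NK HUh).
pose sol xi g := sol0 (xi, g).
have solP xi g : saddle_solution ip Bg Uh (mul (varpi xi)) g (sol xi g) := sol0P (xi, g).
(* Passage between the variational equation and the equation in [L^2]. *)
have mixedP xi g ru : mixed_solution Uh varpi xi g ru <->
    saddle_solution ip Bg Uh (mul (varpi xi)) g ru.
  split=> -[Uu E Br]; split=> //.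
    apply: (ip_eqP ip_scalar ip_norm) => v; rewrite -[RHS]E /form_a L2dot_Lmul.
    exact: ipD.
  move=> v; rewrite /form_a L2dot_Lmul -E.
  exact/esym/ipD.
have sol_uniq xi g ru : saddle_solution ip Bg Uh (mul (varpi xi)) g ru -> ru = sol xi g.
  exact: (sol_unique ip_scalar ipC ip_norm Uh_linear B_below Hwmin w_coercive solP).
(* [get] returns a solution because one exists, and uniqueness identifies it with [sol]. *)
have stateE : state_operator Uh varpi f = fun xi => (sol xi f).2.
  apply/funext => xi; rewrite /state_operator; congr (_.2); apply: sol_uniq.
  apply/mixedP.
  have ex : exists ru, mixed_solution Uh varpi xi f ru by exists (sol xi f); apply/mixedP.
  exact: (@getPex _ [set ru | mixed_solution Uh varpi xi f ru] ex).
have w_lin xi : linear (gateaux varpi xi) by have [] := Hvarpi xi.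
have w_derivable xi v : derivable varpi xi v by have [] := Hvarpi xi.
have w_scalable xi : scalable (gateaux varpi xi).
  move=> a v; pose L : {linear L2 Omega -> Linfty Omega} := HB.pack (gateaux varpi xi)
    (GRing.isLinear.Build R (L2 Omega) (Linfty Omega) *:%R _ (w_lin xi)).
  exact: (linearZ_LR L).
have dw_le xi v : `|'D_v varpi xi| <= varpi_inf * `|v|.
  exact: (le_opnorm (w_scalable xi) (Hderiv xi)).
have dw_sub_le x y v : `|'D_v varpi x - 'D_v varpi y| <= varpi_L * `|x - y| * `|v|.
  apply: (le_opnorm _ (Hlip x y)) => a u.
  by rewrite (w_scalable x) (w_scalable y) scalerBr.
split.
- move=> xi; split; last first.
    exists (sol xi); split.
      exact: (sol_continuous ip_scalar ipC ip_norm Uh_linear B_below (ltW k0)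
        Hwmin (ltW Hwmax) w_coercive w_le solP).
    move=> g; split; first exact/mixedP.
    by move=> ru /mixedP/sol_uniq.
  have aE v1 v2 : form_a varpi xi v1 v2 = ip (mul (varpi xi) v1) v2.
    by rewrite /form_a L2dot_Lmul.
  (* Both constants are independent of [xi]: the first is the coercivity constant, with each [v]
     tested by itself, and the second comes from [B_below]. *)
  exists varpi_min, k^-1; split => //.
  + by rewrite invr_gt0.
  + apply: inf_sup_ge => v Kv v0; exists v; split => //.
    by rewrite aE -expr2 w_coercive.
  + apply/seteqP; split=> [v /= [Kv av]|_ ->] /=.
      apply/eqP; rewrite -normr_eq0 -sqrf_eq0 eq_le sqr_ge0 andbT.
      by rewrite -(ler_pM2l Hwmin) mulr0 -(av v Kv) aE w_coercive.
    have ip0 v : ip v 0 = 0.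
      by rewrite ipC; have := ip_scalar v (-1) 0 0; rewrite scaleN1r oppr0 addr0 mulN1r addNr.
    by split=> [v _|v _]; [exact: ip0|rewrite aE ip0].
  (* With the test element [B u] the form [b] equals [|B u| ^ 2]; [B_below] keeps [B u] nonzero. *)
  + apply: inf_sup_ge => u Uu u0; exists (B u); split => //.
      apply: contra_neq u0 => Bu0; apply/eqP; rewrite -normr_le0.
      by rewrite (le_trans (B_below u))// [Bg u]Bu0 normr0 mulr0.
    rewrite /form_b -L2dot_normE expr2 mulrA ler_wpM2r//.
    by rewrite ler_pdivrMl// B_below.
- rewrite stateE; split.
  + by move=> xi; have [] := solP xi f.
  + eexists => xi; exact: (sol_state_le ip_scalar ipC ip_norm B_below (ltW k0)
      Hwmin (ltW Hwmax) w_coercive w_le solP).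
  + exact: (gateaux_differentiable_state ip_scalar ipC ip_norm Uh_linear B_below
      (ltW k0) Hwmin (ltW Hwmax) mul_linear mul_le w_coercive w_le solP f w_derivable
      dw_le w_lin).
- have c1 : 0 <= k * (1 + varpi_max * varpi_min^-1).
    by rewrite mulr_ge0 ?ltW// addr_gt0// divr_gt0.
  have c2 : 0 <= varpi_min^-1 * `|f| by rewrite mulr_ge0// invr_ge0 ltW.
  rewrite stateE; split.
    (* The pointwise bound is proved first because it determines the constant, whose sign is checked
       afterwards. *)
    eexists => xi; apply: opnorm_le; last first.
      exact: (derive_state_le ip_scalar ipC ip_norm Uh_linear B_below
        (ltW k0) Hwmin (ltW Hwmax) mul_linear mul_le w_coercive w_le solP f
        w_derivable dw_le).
    by rewrite mulr_ge0// mulr_ge0// ltW.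
  eexists => x y; apply: opnorm_le; last first.
    exact: (derive_state_sub_le ip_scalar ipC ip_norm Uh_linear B_below
        (ltW k0) Hwmin (ltW Hwmax) mul_linear mul_le w_coercive w_le solP f (ltW Hwinf)
        w_derivable dw_le dw_sub_le).
  rewrite mulr_ge0// mulr_ge0// mulr_ge0// addr_ge0 ?ltW// mulr_gt0 ?addr_gt0//.
  by rewrite mulr_gt0// invr_gt0.
Qed.
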